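(* Let $n\ge3$, let $H\subseteq\mathbb{C}^n$ be an additive subgroup with $\operatorname{span}_{\mathbb{C}}H=\mathbb{C}^n$, and let $0\ne t\in H$. There exists an $n$-dimensional abelian Lie subalgebra $\mathfrak g_t\subseteq\operatorname{Der}(\mathbb{C}[H])$ such that $\mathbb{C}[H]$ is $\mathfrak g_t$-simple and, as $n$-Lie algebras, $$P(H,t)\cong\frac{[S,\ldots,S]}{\langle\mathbf 1\rangle},\qquad S=S(\mathbb{C}[H],\mathfrak g_t),$$ where $\langle\mathbf 1\rangle=\mathbb{C}\mathbf 1$, with $\mathbf 1$ the identity element of $\mathbb{C}[H]$, is a central ideal of $[S,\ldots,S]$.
   Context: All vector spaces are over $\mathbb{C}$. An $n$-Lie algebra is a vector space $L$ with an alternating $n$-linear bracket satisfying $[x_1,\ldots,x_{n-1},[y_1,\ldots,y_n]]=\sum_{i=1}^n[y_1,\ldots,[x_1,\ldots,x_{n-1},y_i],\ldots,y_n]$. $[S,\ldots,S]$ denotes the derived algebra of $S$, i.e. the linear span of all brackets of elements of $S$. $P(H,t)$: put $\Lambda=H\setminus\{0,t\}$. $P(H,t)$ is the $n$-Lie algebra with basis $\{u_a:a\in\Lambda\}$ and bracket $[u_{a_1},\ldots,u_{a_n}]=\det(a_1,\ldots,a_n)\,u_{a_1+\cdots+a_n+t}$, where $u_0=u_t=0$. $\mathbb{C}[H]=\bigoplus_{a\in H}\mathbb{C}x^a$ is the group algebra, $x^ax^b=x^{a+b}$. For a commutative associative algebra $A$ and a Lie algebra $\mathfrak g\subseteq\operatorname{Der}A$,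 $A$ is $\mathfrak g$-simple if it has no nonzero proper associative ideal invariant under every element of $\mathfrak g$. If $\dim\mathfrak g=n$ and $D_1,\ldots,D_n$ is a basis of $\mathfrak g$, then $S(A,\mathfrak g)$ is the vector space $A$ with the $n$-Lie bracket $[f_1,\ldots,f_n]_S=\det\bigl(D_i(f_j)\bigr)_{1\le i,j\le n}$. *)

(* Defs.v *)
From HB Require Import structures.
From mathcomp Require Import all_boot all_order all_algebra complex finmap.
From mathcomp Require Import all_classical reals.
(* The notations of monalg clash with those of mathcomp-classical. *)
From mathcomp Require Import -(notations) monalg.

Set Implicit Arguments.
Unset Strict Implicit.
Unset Printing Implicit Defensive.

Import GRing.Theory.
Local Open Scope classical_set_scope.
Local Open Scope ring_scope.

Section Span.
Context (K : nzRingType) (V : lmodType K).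

Definition lspan (S : set V) : {pred V} := fun v =>
  `[< exists k (c : 'I_k -> K) (s : 'I_k -> V),
        (forall i, S (s i)) /\ v = \sum_(i < k) c i *: s i >].

Lemma lspan_submod_closed (S : set V) : submod_closed (lspan S).
Proof.
split=> [|a u v /asboolP[k [c [s [hs ->]]]] /asboolP[l [d [r [hr ->]]]]].
  apply/asboolP; exists 0, (fun=> 0), (fun=> 0).
  by split; [case | rewrite big_ord0].
apply/asboolP; exists (k + l)%N.
exists (fun i => match fintype.split i with inl x => a * c x | inr y => d y end).
exists (fun i => match fintype.split i with inl x => s x | inr y => r y end).
split=> [i|]; first by case: fintype.split.
rewrite big_split_ord scaler_sumr; congr (_ + _); apply: eq_bigr => i _.
  by rewrite (unsplitK (inl i)) scalerA.
by rewrite (unsplitK (inr i)).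
Qed.

HB.instance Definition _ (S : set V) :=
  GRing.isSubmodClosed.Build K V (lspan S) (lspan_submod_closed S).

Definition is_basis n (D : 'I_n -> V) (W : submodClosed V) : Prop :=
  (forall c : 'I_n -> K, \sum_(i < n) c i *: D i = 0 -> forall i, c i = 0) /\
  W =i lspan (range D).

Definition has_dim (W : submodClosed V) n : Prop :=
  exists D : 'I_n -> V, is_basis D W.

End Span.

Section Subgroup.
Context (V : zmodType) (H : zmodClosed V).

Definition subgrp := {x : V | x \in H}.
HB.instance Definition _ := SubChoice.on subgrp.
HB.instance Definition _ := [SubChoice_isSubZmodule of subgrp by <:].

End Subgroup.

Section Subspace.
Context (K : nzRingType) (V : lmodType K) (W : submodClosed V).

Definition subspace := {x : V | x \in W}.
HB.instance Definition _ := SubChoice.on subspace.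
HB.instance Definition _ := [SubChoice_isSubLmodule of subspace by <:].

End Subspace.

Section QuotientSpace.
Local Open Scope quotient_scope.
Context (K : nzRingType) (V : lmodType K) (W : submodClosed V).

(* Over a ring, a [submodClosed] predicate is stable by opposite; MathComp's
   quotient needs this as a [zmodClosed] structure. *)
Definition zmod_of_submod : {pred V} := W.

Lemma zmod_of_submod_closed : zmod_closed zmod_of_submod.
Proof.
rewrite /zmod_of_submod; split=> [|u v uW vW]; first exact: rpred0.
by rewrite -scaleN1r rpredD // rpredZ.
Qed.

HB.instance Definition _ :=
  GRing.isZmodClosed.Build V zmod_of_submod zmod_of_submod_closed.

Definition quotsp := Quotient.quot zmod_of_submod.
HB.instance Definition _ := GRing.Zmodule.on quotsp.
HB.instance Definition _ := Quotient.on quotsp.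

Definition quotsp_scale (c : K) (x : quotsp) : quotsp :=
  \pi_quotsp (c *: repr x).

Lemma quotsp_piD : {morph \pi_quotsp : u v / u + v}.
Proof. by move=> u v; rewrite piE. Qed.

Lemma quotsp_piP (u v : V) :
  reflect (\pi_quotsp u = \pi_quotsp v) (u - v \in W).
Proof. by rewrite (Quotient.idealrBE zmod_of_submod); apply: eqP. Qed.

Lemma quotsp_piZ c (v : V) :
  quotsp_scale c (\pi_quotsp v) = \pi_quotsp (c *: v).
Proof.
apply/quotsp_piP; rewrite -scalerBr rpredZ //.
by apply/quotsp_piP; rewrite [LHS]reprK.
Qed.

Fact quotsp_scaleA a b x :
  quotsp_scale a (quotsp_scale b x) = quotsp_scale (a * b) x.
Proof. by elim/quotW: x => v; rewrite (quotsp_piZ b) !quotsp_piZ scalerA. Qed.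

Fact quotsp_scale1 : left_id 1 quotsp_scale.
Proof. by elim/quotW=> v; rewrite quotsp_piZ scale1r. Qed.

Fact quotsp_scaleDr : right_distributive quotsp_scale +%R.
Proof.
move=> c; elim/quotW=> u; elim/quotW=> v.
by rewrite -quotsp_piD !quotsp_piZ scalerDr quotsp_piD.
Qed.

Fact quotsp_scaleDl x : {morph quotsp_scale^~ x : a b / a + b}.
Proof.
by move=> a b; elim/quotW: x => v; rewrite !quotsp_piZ scalerDl quotsp_piD.
Qed.

HB.instance Definition _ := GRing.Zmodule_isLmodule.Build K quotsp
  quotsp_scaleA quotsp_scale1 quotsp_scaleDr quotsp_scaleDl.

End QuotientSpace.

Section GroupAlgebra.
Context (G : zmodType) (K : comNzRingType).
Implicit Types (f g h : malg G K).

(* [monalg] turns [malg G K] into a ring only for monomial types [G], whose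
   axioms exclude nontrivial groups; the product below is the same convolution
   product for an additive group of exponents. *)
Definition grpalg := malg G K.
HB.instance Definition _ := GRing.Lmodule.on grpalg.

Definition gpow (a : G) : grpalg := mkmalgU a 1.

Definition grpalg_mul f g : malg G K :=
  \sum_(a <- msupp f) \sum_(b <- msupp g)
    mkmalgU (a + b) (mcoeff a f * mcoeff b g).

Lemma grpalg_mulw (d1 d2 : {fset G}) f g :
  (msupp f `<=` d1)%fset -> (msupp g `<=` d2)%fset ->
  grpalg_mul f g =
  \sum_(a <- d1) \sum_(b <- d2) mkmalgU (a + b) (mcoeff a f * mcoeff b g).
Proof.
move=> le1 le2; rewrite /grpalg_mul (big_fset_incl _ le1) /=.
  apply/eq_bigr=> a _; apply/big_fset_incl => // b _ /mcoeff_outdom ->.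
  by rewrite mulr0 monalgU0.
move=> a _ /mcoeff_outdom fa; rewrite big1 // => b _.
by rewrite fa mul0r monalgU0.
Qed.

Lemma grpalg_mulC : commutative grpalg_mul.
Proof.
move=> f g; rewrite /grpalg_mul exchange_big; apply: eq_bigr => b _.
by apply: eq_bigr => a _; rewrite addrC mulrC.
Qed.

Lemma grpalg_mulDl : left_distributive grpalg_mul +%R.
Proof.
move=> f g h.
rewrite [in RHS](grpalg_mulw (fsubsetUl _ (msupp g)) (fsubset_refl _)).
rewrite [in RHS](grpalg_mulw (fsubsetUr (msupp f) _) (fsubset_refl _)).
rewrite (grpalg_mulw (msuppD_le _ _) (fsubset_refl _)).
rewrite -big_split /=; apply/eq_bigr=> a _.
rewrite -big_split /=; apply/eq_bigr=> b _.
by rewrite mcoeffD mulrDl monalgUD.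
Qed.

Lemma grpalg_mulDr : right_distributive grpalg_mul +%R.
Proof. by move=> f g h; rewrite grpalg_mulC grpalg_mulDl !(grpalg_mulC f). Qed.

Lemma grpalg_mul0g : left_zero 0 grpalg_mul.
Proof. by move=> f; rewrite /grpalg_mul msupp0 big_seq_fset0. Qed.

Lemma grpalg_mulg0 : right_zero 0 grpalg_mul.
Proof. by move=> f; rewrite grpalg_mulC grpalg_mul0g. Qed.

Lemma grpalg_mulUU a b (c d : K) :
  grpalg_mul (mkmalgU a c) (mkmalgU b d) = mkmalgU (a + b) (c * d).
Proof.
rewrite (grpalg_mulw msuppU_le msuppU_le).
by rewrite !big_seq_fset1 !mcoeffUU.
Qed.

Lemma grpalg_mul_suml I (r : seq I) (F : I -> malg G K) g :
  grpalg_mul (\sum_(i <- r) F i) g = \sum_(i <- r) grpalg_mul (F i) g.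
Proof.
exact: (big_morph (grpalg_mul^~ g) (fun _ _ => grpalg_mulDl _ _ _)
                  (grpalg_mul0g _)).
Qed.

Lemma grpalg_mul_sumr I (r : seq I) (F : I -> malg G K) g :
  grpalg_mul g (\sum_(i <- r) F i) = \sum_(i <- r) grpalg_mul g (F i).
Proof.
by rewrite grpalg_mulC grpalg_mul_suml; apply: eq_bigr => i _;
  rewrite grpalg_mulC.
Qed.

Lemma grpalg_mulA : associative grpalg_mul.
Proof.
move=> f g h; rewrite [f]monalgE [g]monalgE [h]monalgE.
rewrite grpalg_mul_suml [in RHS]grpalg_mul_suml [in RHS]grpalg_mul_suml.
apply: eq_bigr => a _.
rewrite grpalg_mul_suml grpalg_mul_sumr (grpalg_mul_sumr _ _ (mkmalgU a _)).
rewrite [in RHS]grpalg_mul_suml.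
apply: eq_bigr => b _; rewrite !grpalg_mul_sumr; apply: eq_bigr => c _.
by rewrite !grpalg_mulUU addrA mulrA.
Qed.

Lemma grpalg_mul1g : left_id (gpow 0) grpalg_mul.
Proof.
move=> f; rewrite [f]monalgE grpalg_mul_sumr; apply: eq_bigr => a _.
by rewrite grpalg_mulUU add0r mul1r.
Qed.

Lemma gpow0_neq0 : gpow 0 != 0.
Proof. by rewrite monalgU_eq0 oner_eq0. Qed.

HB.instance Definition _ := GRing.Zmodule_isComNzRing.Build grpalg
  grpalg_mulA grpalg_mulC grpalg_mul1g grpalg_mulDl gpow0_neq0.

Lemma grpalg_scaleAl (c : K) (f g : grpalg) : c *: (f * g) = (c *: f) * g.
Proof.
rewrite [f * g](grpalg_mulw (fsubset_refl _) (fsubset_refl _)).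
rewrite [_ * g](grpalg_mulw (msuppZ_le _ _) (fsubset_refl _)).
rewrite scaler_sumr; apply: eq_bigr => a _.
rewrite scaler_sumr; apply: eq_bigr => b _.
by apply/malgP => k; rewrite !mcoeffsE mulrnAr mulrA.
Qed.

HB.instance Definition _ :=
  GRing.Lmodule_isLalgebra.Build K grpalg grpalg_scaleAl.
HB.instance Definition _ := GRing.Lalgebra_isComAlgebra.Build K grpalg.

Lemma gpowD (a b : G) : gpow (a + b) = gpow a * gpow b.
Proof. by rewrite [RHS]grpalg_mulUU mulr1. Qed.

Lemma gpow_0 : gpow 0 = 1. Proof. by []. Qed.

End GroupAlgebra.

Section NLie.
Context (K : nzRingType) (n : nat).

Section Brackets.
Context (L : lmodType K).
Implicit Types (br : ('I_n -> L) -> L) (x y : 'I_n -> L).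

Definition n_linear br : Prop := forall x i (c : K) (u v : L),
  br [eta x with i |-> c *: u + v] =
  c *: br [eta x with i |-> u] + br [eta x with i |-> v].

Definition n_alternating br : Prop :=
  forall x (i j : 'I_n), i != j -> x i = x j -> br x = 0.

(* [br [eta x with l |-> z]], for [l] the last index, is
   [x_1, ..., x_{n-1}, z]; the value [x l] plays no role. *)
Definition n_fundamental br : Prop :=
  forall x y (l : 'I_n), l.+1 = n ->
  br [eta x with l |-> br y] =
  \sum_(i < n) br [eta y with i |-> br [eta x with l |-> y i]].

Definition is_nLie br : Prop :=
  [/\ n_linear br, n_alternating br & n_fundamental br].

Definition is_nLie_ideal br (I : submodClosed L) : Prop :=
  forall x i, x i \in I -> br x \in I.

Definition nLie_central br (I : submodClosed L) : Prop :=
  forall x i, x i \in I -> br x = 0.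

Definition derived br : {pred L} := lspan (range br).
HB.instance Definition _ br := GRing.SubmodClosed.on (derived br).

Lemma bracket_derived br x : br x \in derived br.
Proof.
apply/asboolP; exists 1%N, (fun=> 1), (fun=> br x).
by split=> [_|]; [exists x | rewrite big_ord1 scale1r].
Qed.

Definition derived_alg br := subspace (derived br).
HB.instance Definition _ br := GRing.Lmodule.on (derived_alg br).
HB.instance Definition _ br := SubChoice.on (derived_alg br).

Definition derived_bracket br (x : 'I_n -> derived_alg br) : derived_alg br :=
  exist _ (br (val \o x)) (bracket_derived br (val \o x)).

(* The bracket of classes, computed on representatives; it does not depend on
   their choice when [I] is an ideal for an n-linear bracket. *)
Definition quot_bracket br (I : submodClosed L) (x : 'I_n -> quotsp I) :
  quotsp I := (\pi_(quotsp I) (br (fun i => repr (x i))))%qT.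

(* The line spanned by [z], as a subspace of the derived algebra; it is
   meaningful only when [z \in derived br]. *)
Definition derived_line br (z : L) : {pred derived_alg br} :=
  lspan [set x : derived_alg br | val x = z].
HB.instance Definition _ br z := GRing.SubmodClosed.on (@derived_line br z).

End Brackets.

Definition nLie_isomorphic (L M : lmodType K)
    (brL : ('I_n -> L) -> L) (brM : ('I_n -> M) -> M) : Prop :=
  [/\ is_nLie brL, is_nLie brM &
      exists phi : {linear L -> M},
        bijective phi /\ forall x, phi (brL x) = brM (phi \o x)].

End NLie.

Arguments derived_bracket {K n L} br x.
Arguments derived_line {K n L} br z.
Arguments quot_bracket {K n L} br I x.

Section Derivations.
Context (K : comNzRingType) (A : comAlgType K).

Definition is_derivation (D : A -> A) : Prop :=
  (forall (c : K) f g, D (c *: f + g) = c *: D f + D g) /\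
  (forall f g, D (f * g) = D f * g + f * D g).

Definition commutator (D E : A -> A) : A -> A := fun f => D (E f) - E (D f).

Definition is_lie_subalgebra_Der (g : submodClosed (A -> A)) : Prop :=
  (forall D, D \in g -> is_derivation D) /\
  (forall D E, D \in g -> E \in g -> commutator D E \in g).

Definition lie_abelian (g : submodClosed (A -> A)) : Prop :=
  forall D E, D \in g -> E \in g -> commutator D E = 0.

(* [idealr_closed I]: [I] is an ideal of [A] that does not contain [1], i.e. a
   proper ideal. *)
Definition g_simple (g : submodClosed (A -> A)) : Prop :=
  ~ exists I : {pred A},
      [/\ idealr_closed I, exists2 f, f \in I & f != 0 &
          forall D f, D \in g -> f \in I -> D f \in I].

Definition S_bracket n (D : 'I_n -> A -> A) (f : 'I_n -> A) : A :=
  \det (\matrix_(i, j) D i (f j)).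

End Derivations.

Section PHt.
Context (K : comNzRingType) (n : nat) (H : zmodClosed 'rV[K]_n).
Variable t : subgrp H.

Definition Lambda := {a : subgrp H | (a != 0) && (a != t)}.

Definition P_space := malg Lambda K.
HB.instance Definition _ := GRing.Lmodule.on P_space.

Definition u_ (b : subgrp H) : P_space :=
  if insub b is Some a then mkmalgU (a : Lambda) 1 else 0.

(* The n-linear extension of
   [u_{a_1}, ..., u_{a_n}] = det(a_1, ..., a_n) u_{a_1 + ... + a_n + t}. *)
Definition P_bracket (f : 'I_n -> P_space) : P_space :=
  \sum_(a \in [set: {ffun 'I_n -> Lambda}])
    ((\prod_(i < n) mcoeff (a i) (f i)) *
     \det (\matrix_(i, j) val (val (a j)) 0 i)) *:
    u_ (\sum_(j < n) val (a j) + t).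

Lemma P_bracket_basis (a : 'I_n -> Lambda) :
  P_bracket (fun i => u_ (val (a i))) =
  \det (\matrix_(i, j) val (val (a j)) 0 i) *: u_ (\sum_(j < n) val (a j) + t).
Proof.
have uE (x : Lambda) : u_ (val x) = mkmalgU x 1 by rewrite /u_ valK.
have coef0 (b : {ffun 'I_n -> Lambda}) : b <> finfun a ->
    \prod_(i < n) mcoeff (b i) (u_ (val (a i))) = 0.
  move=> nab; have [i abi] : exists i, a i != b i.
    apply/existsP; rewrite -negb_forall; apply/negP => /forallP e.
    by apply: nab; apply/ffunP => i; rewrite ffunE; apply/esym/eqP.
  by rewrite (bigD1 i) //= uE mcoeffU (negPf abi) mul0r.
rewrite /P_bracket -(fsbig_widen [set finfun a]) => //; last first.
  by move=> b [_ /coef0 b0] /=; rewrite b0 mul0r scale0r.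
rewrite fsbig_set1 big1 ?mul1r => [|i _]; last by rewrite uE ffunE mcoeffUU.
have aE i : finfun a i = a i by rewrite ffunE.
under eq_bigr do rewrite aE.
by under [X in \det X]eq_mx do rewrite aE.
Qed.

End PHt.

Arguments P_bracket {K n H} t f.

(* Main.v *)
(* Choose a basis of linear forms w_1, ..., w_n on C^n such that w_i(t) = 0 for
   all i but one, say i0, and let D_i (x^a) = w_i(a) x^a for i != i0 and
   D_i0 (x^a) = w_i0(a) x^(a + t). These derivations commute since w_i(t) = 0 for
   i != i0, and det (D_i (x^(a_j))) is a nonzero constant c times
   det(a_1, ..., a_n) x^(a_1 + ... + a_n + t). A change of basis of their span
   only changes c. By multilinearity everything about the n-Lie bracket is checked
   on monomials: the fundamental identity becomes Cramer's rule, the derived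
   algebra is the span of the x^b with b != t (x^t would need a_1 + ... + a_n = 0,
   where the determinant vanishes), and killing x^0 leaves P(H,t) up to the
   rescaling u_a = s x^a with s^(n-1) c = 1. An invariant ideal contains a
   monomial, hence 1: unless f is a monomial, subtracting from a weight operator
   applied to f a multiple of f shortens the support of f. *)
Require Import Defs.
From HB Require Import structures.
From mathcomp Require Import all_boot all_order all_algebra complex finmap.
From mathcomp Require Import all_classical reals.
From mathcomp Require Import -(notations) monalg.

Set Implicit Arguments.
Unset Strict Implicit.
Unset Printing Implicit Defensive.

Import GRing.Theory Num.Theory.
Local Open Scope classical_set_scope.
Local Open Scope ring_scope.

(** * Multilinear maps on monomials *)

Section Update.
Context (n : nat) (V : Type).
Implicit Types (x : 'I_n -> V) (u v : V).

Lemma upd_same x i : [eta x with i |-> x i] = x :> ('I_n -> V).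
Proof. by apply/funext => j /=; case: eqP => [->|]. Qed.

Lemma upd_upd x i u v :
  [eta [eta x with i |-> u] with i |-> v] = [eta x with i |-> v] :> ('I_n -> V).
Proof. by apply/funext => j /=; case: eqP. Qed.

Lemma upd_comm x i j u v : i != j ->
  [eta [eta x with i |-> u] with j |-> v] =
  [eta [eta x with j |-> v] with i |-> u] :> ('I_n -> V).
Proof.
move=> ij; apply/funext => k /=; case: eqP => // ->.
by rewrite eq_sym (negPf ij).
Qed.

Lemma comp_upd (W : Type) (f : V -> W) x i u :
  f \o [eta x with i |-> u] = [eta f \o x with i |-> f u] :> ('I_n -> W).
Proof. by apply/funext => j /=; case: eqP. Qed.

End Update.

Lemma sum_upd (V : zmodType) m (x : 'I_m -> V) i u :
  \sum_j [eta x with i |-> u] j = u + \sum_j x j - x i.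
Proof.
rewrite (bigD1 i) //= eqxx [in RHS](bigD1 i) //= [x i + _]addrC addrA addrK.
by congr (_ + _); apply: eq_bigr => j /negPf ->.
Qed.

Section SlotLinear.
Context (K : nzRingType) (n : nat) (V W : lmodType K).
Implicit Types (F : ('I_n -> V) -> W) (x : 'I_n -> V) (i : 'I_n).

(** Linearity in one slot only, with values in a possibly different module. A bracket, one
    coefficient of it, and the difference of two sides of an identity can thus be treated slot by
    slot. *)
Definition slot_linear F i := forall x (c : K) u v,
  F [eta x with i |-> c *: u + v] =
  c *: F [eta x with i |-> u] + F [eta x with i |-> v].

Lemma slot_linear0 F i x : slot_linear F i -> F [eta x with i |-> 0] = 0.
Proof.
by move=> Fi; have := Fi x (-1) 0 0; rewrite scaler0 addr0 scaleN1r addNr.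
Qed.

Lemma slot_linearD F i x u v : slot_linear F i ->
  F [eta x with i |-> u + v] = F [eta x with i |-> u] + F [eta x with i |-> v].
Proof. by move=> Fi; have := Fi x 1 u v; rewrite !scale1r. Qed.

Lemma slot_linearZ F i x c u : slot_linear F i ->
  F [eta x with i |-> c *: u] = c *: F [eta x with i |-> u].
Proof. by move=> Fi; have := Fi x c u 0; rewrite (slot_linear0 _ Fi) !addr0. Qed.

Lemma slot_linear_sum F i x I (r : seq I) (f : I -> V) : slot_linear F i ->
  F [eta x with i |-> \sum_(k <- r) f k] = \sum_(k <- r) F [eta x with i |-> f k].
Proof.
move=> Fi; apply: (big_morph (fun v => F [eta x with i |-> v])).
  by move=> u v; apply: slot_linearD.
exact: slot_linear0.
Qed.

Lemma slot_linearB F G i :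
  slot_linear F i -> slot_linear G i -> slot_linear (fun x => F x - G x) i.
Proof. by move=> Fi Gi x c u v; rewrite Fi Gi opprD addrACA scalerBr. Qed.

Lemma slot_linear_bigsum I (r : seq I) (F : I -> ('I_n -> V) -> W) i :
  (forall k, slot_linear (F k) i) -> slot_linear (fun x => \sum_(k <- r) F k x) i.
Proof.
move=> Fi x c u v; rewrite scaler_sumr -big_split; apply: eq_bigr => k _.
exact: Fi.
Qed.

Lemma slot_linear_upd F i j z : i != j -> slot_linear F i ->
  slot_linear (fun x => F [eta x with j |-> z]) i.
Proof. by move=> ij Fi x c u v; rewrite !(upd_comm _ _ _ ij) Fi. Qed.

End SlotLinear.

Section MalgExt.
Context (K : nzRingType) (n : nat) (X : choiceType) (W : lmodType K).

Lemma malgU_scale (a : X) (c : K) : mkmalgU a c = c *: mkmalgU a 1.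
Proof. by apply/malgP => k; rewrite mcoeffZ !mcoeffU mulrnAr mulr1. Qed.

(* The slots outside [P] are spectators: nothing is assumed of them. *)
Lemma slot_linear_ext (P : {pred 'I_n}) (F : ('I_n -> malg X K) -> W) :
    (forall i, i \in P -> slot_linear F i) ->
    (forall x, (forall i, i \in P -> exists a, x i = mkmalgU a 1) -> F x = 0) ->
  forall x, F x = 0.
Proof.
move=> Flin F0 x.
suff ind (s : seq 'I_n) : forall x, (forall i, i \in P -> i \notin s ->
    exists a, x i = mkmalgU a 1) -> F x = 0.
  by apply: (ind (enum 'I_n)) => i _; rewrite mem_enum.
elim: s => [|k s IHs] {}x xs; first by apply: F0 => i /xs; apply.
have [kP|kP] := boolP (k \in P); last first.
  apply: IHs => i iP si; apply: xs => //.
  by rewrite inE negb_or si andbT; apply: contraNneq kP => <-.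
rewrite -[x](upd_same _ k) [x k]monalgE slot_linear_sum; last exact: Flin.
rewrite big1 // => b _; rewrite malgU_scale slot_linearZ; last exact: Flin.
rewrite IHs ?scaler0 // => i iP si /=.
case: eqP => [_|/eqP ik]; first by exists b.
by apply: xs => //; rewrite inE negb_or ik.
Qed.

End MalgExt.

(** * Determinants and Cramer's rule *)

Section Determinant.
Context (K : comNzRingType) (n : nat).
Implicit Types (a b : 'I_n -> 'rV[K]_n) (u v : 'rV[K]_n).

Definition dt a := \det (\matrix_(i, j) a j 0 i).

(** Expansion along slot [i]: the cofactors do not involve that slot, so the determinant is a linear
    form in [v], read off the adjugate. Linearity, Cramer's rule and the sum arguments below all
    rest on this formula. *)
Lemma dt_upd a i v :
  dt [eta a with i |-> v] = (v *m \adj (\matrix_(k, j) a k 0 j)) 0 i.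
Proof.
rewrite /dt -det_tr (expand_det_row _ i) mxE; apply: eq_bigr => j _.
rewrite !mxE /= eqxx; congr (_ * _); rewrite /cofactor; congr (_ * \det _).
by apply/matrixP => p q; rewrite !mxE /= eq_sym (negPf (neq_lift _ _)).
Qed.

Lemma dt_slot_linear i : slot_linear (dt : _ -> K^o) i.
Proof.
by move=> a c u v; rewrite !dt_upd mulmxDl -scalemxAl mxE [X in X + _]mxE.
Qed.

Lemma dt_alt a i j : i != j -> a i = a j -> dt a = 0.
Proof.
move=> ij aij; rewrite /dt -det_tr; apply: (determinant_alternate ij) => k.
by rewrite !mxE aij.
Qed.

(** Cramer's rule, the expansion of [dt b *: v] in the vectors [b i], after applying the linear form
    [dt [eta a with l |-> _]]. In matrices, with [B] the rows [b], both sides are an entry of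
    [v *m \adj B *m B *m w]. *)
Lemma dt_cramer a b l v :
  \sum_i dt [eta a with l |-> b i] * dt [eta b with i |-> v] =
  dt b * dt [eta a with l |-> v].
Proof.
set B := \matrix_(k, j) b k 0 j.
have -> : dt b = \det B.
  by rewrite /dt -det_tr; congr (\det _); apply/matrixP => i j; rewrite !mxE.
rewrite dt_upd; set w := \adj _.
transitivity ((v *m \adj B *m (B *m w)) 0 l); last first.
  by rewrite mulmxA -(mulmxA v) mul_adj_mx mul_mx_scalar -scalemxAl [LHS]mxE.
rewrite [RHS]mxE; apply: eq_bigr => i _; rewrite !dt_upd mulrC; congr (_ * _).
by rewrite [LHS]mxE [RHS]mxE; apply: eq_bigr => j _; rewrite [in RHS]mxE.
Qed.

(** Putting the zero sum into slot [i0] gives 0, and also [dt a], because every summand [a i] with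
    [i != i0] repeats another slot. *)
Lemma dt_sum0 a : (0 < n)%N -> \sum_i a i = 0 -> dt a = 0.
Proof.
move=> n0 a0; pose i0 := Ordinal n0.
have /(congr1 (fun v => (v *m \adj (\matrix_(k, j) a k 0 j)) 0 i0)) := a0.
rewrite mul0mx [RHS]mxE => <-; rewrite mulmx_suml summxE (bigD1 i0) //=.
rewrite big1 ?addr0 => [|i ii0]; first by rewrite -dt_upd upd_same.
by rewrite -dt_upd; apply: (dt_alt ii0); rewrite /= ?eqxx if_same.
Qed.

End Determinant.

(** * Induction on linear spans *)

Section Span.
Context (K : nzRingType) (L : lmodType K).

Lemma lspanP (S : set L) (P : L -> Prop) :
    P 0 -> (forall k u v, P u -> P v -> P (k *: u + v)) -> (forall v, S v -> P v) ->
  forall v, v \in lspan S -> P v.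
Proof.
move=> P0 PD PS v /asboolP[k [d [s [sS ->]]]].
elim/big_rec: _ => // i u _; apply: PD; exact/PS.
Qed.

Lemma lspan_mem (S : set L) v : S v -> v \in lspan S.
Proof.
move=> Sv; apply/asboolP; exists 1%N, (fun=> 1), (fun=> v).
by rewrite big_ord1 scale1r.
Qed.

Lemma lspan_rangeP n (D : 'I_n -> L) v : v \in lspan (range D) ->
  exists c : 'I_n -> K, v = \sum_i c i *: D i.
Proof.
move: v; apply: lspanP => [|k u v [c ->] [d ->]|v [i _ <-]].
- by exists (fun=> 0); rewrite big1 // => i _; rewrite scale0r.
- exists (fun i => k * c i + d i); rewrite scaler_sumr -big_split /=.
  by apply: eq_bigr => i _; rewrite scalerA scalerDl.
- exists (fun j => (i == j)%:R); rewrite (bigD1 i) //= eqxx scale1r big1 ?addr0 //.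
  by move=> j ji; rewrite eq_sym (negPf ji) scale0r.
Qed.

End Span.

(** * Transport and quotients of n-Lie brackets *)

Section NLieMorphisms.
Context (K : nzRingType) (n : nat).

(** The axioms are identities, so they pull back along an injective morphism. This serves for the
    derived algebra inside [S] and for P(H,t) inside the quotient. *)
Lemma nLie_inj (L M : lmodType K) (brL : ('I_n -> L) -> L)
    (brM : ('I_n -> M) -> M) (phi : {linear L -> M}) :
    injective phi -> (forall x, phi (brL x) = brM (phi \o x)) ->
  is_nLie brM -> is_nLie brL.
Proof.
move=> phiI phiM [lin alt fund]; split=> [x i c u v|x i j ij xij|x y l ln].
- by apply: phiI; rewrite linearP !phiM !comp_upd linearP lin.
- by apply: phiI; rewrite phiM linear0 (alt _ i j) //= xij.
- apply: phiI; rewrite linear_sum phiM comp_upd phiM fund //.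
  by apply: eq_bigr => i _; rewrite phiM comp_upd phiM comp_upd.
Qed.

Section Quotient.
Local Open Scope quotient_scope.
Context (L : lmodType K) (br : ('I_n -> L) -> L) (I : submodClosed L).
Hypotheses (brN : is_nLie br) (idI : is_nLie_ideal br I).
Implicit Types (x y : 'I_n -> L).

(** The entries of [x] are exchanged for those of [y] one slot at a time; each exchange costs a
    bracket with an entry in [I]. The list [s] holds the slots still to be exchanged. *)
Lemma nLie_ideal_congr x y :
  (forall i, x i - y i \in I) -> br x - br y \in I.
Proof.
have [lin _ _] := brN.
suff ind (s : seq 'I_n) : forall x, (forall i, i \notin s -> x i = y i) ->
    (forall i, x i - y i \in I) -> br x - br y \in I.
  by apply: (ind (enum 'I_n)) => i; rewrite mem_enum.
elim: s => [|k s IHs] {}x xs xy.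
  have -> : x = y by apply/funext => i; apply: xs.
  by rewrite subrr rpred0.
have xE : br x = br [eta x with k |-> x k - y k] + br [eta x with k |-> y k].
  rewrite -[in LHS](upd_same x k) -[in LHS](subrK (y k) (x k)).
  by have := lin x k 1 (x k - y k) (y k); rewrite !scale1r.
rewrite xE -addrA rpredD //; first by apply: (idI (i := k)); rewrite /= eqxx.
apply: IHs => [i si|i] /=; case: eqVneq => [->|ik] //.
  by apply: xs; rewrite inE negb_or ik.
by rewrite subrr rpred0.
Qed.

Lemma quotsp_pi_linear : linear (\pi_(quotsp I) : L -> quotsp I).
Proof. by move=> c u v; rewrite quotsp_piD -quotsp_piZ. Qed.

Lemma quot_bracket_pi x :
  quot_bracket br I (fun i => \pi_(quotsp I) (x i)) = \pi_(quotsp I) (br x).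
Proof.
apply/quotsp_piP; apply: nLie_ideal_congr => i; apply/quotsp_piP.
by rewrite [LHS]reprK.
Qed.

Lemma quot_bracket_nLie : is_nLie (quot_bracket br I).
Proof.
have [lin alt fund] := brN.
have piE (x : 'I_n -> quotsp I) : x = (fun i => \pi_(quotsp I) (repr (x i))).
  by apply/funext => i; rewrite reprK.
have piU x i u : [eta fun j => \pi_(quotsp I) (x j) with i |-> \pi_(quotsp I) u] =
    (fun j => \pi_(quotsp I) ([eta x with i |-> u] j)) :> ('I_n -> quotsp I).
  by apply/funext => j /=; case: eqP.
split=> [x i c u v|x i j ij xij|x y l ln].
- rewrite (piE x) -[u]reprK -[v]reprK -quotsp_pi_linear !piU !quot_bracket_pi.
  by rewrite lin quotsp_pi_linear.
- rewrite (piE x) /quot_bracket.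
  have -> : (fun k => repr (\pi_(quotsp I) (repr (x k)))) = repr \o x.
    by apply/funext => k /=; rewrite reprK.
  have -> : br (repr \o x) = 0 by apply: (alt _ i j ij); rewrite /= xij.
  exact: (raddf0 (\pi_(quotsp I))).
- rewrite (piE x) (piE y) quot_bracket_pi piU quot_bracket_pi fund //.
  rewrite (big_morph \pi_(quotsp I) (@quotsp_piD _ _ _) (raddf0 (\pi_(quotsp I)))).
  apply: eq_bigr => i _; rewrite -quot_bracket_pi -piU; congr (quot_bracket br I _).
  have -> : quot_bracket br I [eta fun j => \pi_(quotsp I) (repr (x j))
      with l |-> \pi_(quotsp I) (repr (y i))] =
      \pi_(quotsp I) (br [eta fun j => repr (x j) with l |-> repr (y i)]).
    by rewrite piU quot_bracket_pi.
  by [].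
Qed.

End Quotient.

End NLieMorphisms.

(** * Reduction to monomials in the group algebra *)

Lemma grpalg_ind (G : zmodType) (K : comNzRingType) (P : grpalg G K -> Prop) :
    (forall a, P (gpow K a)) ->
    (forall (k : K) u v, P u -> P v -> P (k *: u + v)) ->
  forall f, P f.
Proof.
move=> PU PD f; rewrite [f]monalgE; elim/big_rec: _ => [|a g _ Pg].
  by have := PD (-1) _ _ (PU 0) (PU 0); rewrite scaleN1r addNr.
by rewrite malgU_scale; apply: PD Pg; apply: PU.
Qed.

Section Monomials.
Context (K : comNzRingType) (G : zmodType).
Local Notation A := (grpalg G K).

Lemma mcoeff_gpow (a b : G) : mcoeff b (gpow K a) = (a == b)%:R :> K.
Proof. by rewrite mcoeffU. Qed.

Lemma mcoeff_gpowM (s b : G) (f : A) : mcoeff b (gpow K s * f) = mcoeff (b - s) f.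
Proof.
move: f; apply: grpalg_ind => [a|k u v su sv].
  apply: (etrans (congr1 (mcoeff b) (esym (gpowD K s a)))).
  rewrite (mcoeff_gpow (s + a)) (mcoeff_gpow a) addrC.
  by rewrite -{1}[b](subrK s) (inj_eq (addIr s)).
have lin c (w1 w2 : A) : mcoeff c (k *: w1 + w2) = k * mcoeff c w1 + mcoeff c w2.
  by rewrite mcoeffD mcoeffZ.
have e (w : A) : w * (k *: u + v) = k *: (w * u) + w * v.
  by rewrite mulrDr -scalerAr.
apply: (etrans (congr1 (mcoeff b) (e _))); apply: (etrans (lin _ _ _)).
by apply: etrans (esym (lin _ _ _)); congr (k * _ + _).
Qed.

End Monomials.

Lemma grpalg_slot_linear_ext (K : comNzRingType) (G : zmodType) (W : lmodType K)
    n (P : {pred 'I_n}) (F : ('I_n -> grpalg G K) -> W) :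
    (forall i, i \in P -> slot_linear F i) ->
    (forall (x : 'I_n -> grpalg G K) (a : 'I_n -> G),
       (forall i, i \in P -> x i = gpow K (a i)) -> F x = 0) ->
  forall x, F x = 0.
Proof.
move=> Flin F0; apply: (slot_linear_ext Flin) => x xM.
have /choice[a xa] : forall i, exists a : G, i \in P -> x i = gpow K a.
  move=> i; have [/xM[a xa]|_] := boolP (i \in P); first by exists a.
  by exists 0.
exact: (F0 x a).
Qed.

(** * Determinants of tuples in H *)

Section WeightDeterminant.
Context (K : fieldType) (n : nat) (H : zmodClosed 'rV[K]_n) (t : subgrp H).
Local Notation G := (subgrp H).

Definition dtG (a : 'I_n -> G) : K := dt (val \o a).

Lemma dtG_upd (a : 'I_n -> G) i g :
  dtG [eta a with i |-> g] = dt [eta val \o a with i |-> val g].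
Proof. by rewrite /dtG comp_upd. Qed.

Lemma valGD : {morph (fun g : G => val g) : g h / g + h}.
Proof. by move=> g h; rewrite raddfD. Qed.

(** The scalar identity left of the fundamental identity when all entries are monomials. Slot [i] of
    [b] receives [b i + s]: the part [b i] restores [dtG b], and the part [s] is summed by Cramer's
    rule. *)
Lemma fundamental_dtG (a b : 'I_n -> G) l :
  dtG b * dtG [eta a with l |-> \sum_i b i + t] =
  \sum_i dtG [eta a with l |-> b i] *
         dtG [eta b with i |-> \sum_j [eta a with l |-> b i] j + t].
Proof.
pose s := \sum_(j | j != l) a j + t.
have slotD (f : 'I_n -> 'rV[K]_n) i u v : dt [eta f with i |-> u + v] =
    dt [eta f with i |-> u] + dt [eta f with i |-> v].
  by rewrite (slot_linearD _ _ _ (@dt_slot_linear K n i)).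
have bs i : \sum_j [eta a with l |-> b i] j + t = b i + s.
  rewrite (bigD1 l) //= eqxx -addrA; congr (_ + (_ + _)).
  by apply: eq_bigr => j /negPf ->.
have phiD g h : dtG [eta a with l |-> g + h] =
    dtG [eta a with l |-> g] + dtG [eta a with l |-> h].
  by rewrite !dtG_upd raddfD slotD.
have phi_sum I (r : seq I) (P : pred I) (f : I -> G) :
    dtG [eta a with l |-> \sum_(k <- r | P k) f k] =
    \sum_(k <- r | P k) dtG [eta a with l |-> f k].
  apply: (big_morph (fun g => dtG [eta a with l |-> g]) phiD).
  by rewrite dtG_upd raddf0 (slot_linear0 _ (@dt_slot_linear K n l)).
(* Here [t] may be replaced by [s], since the other summands of [s] repeat slots of [a]. *)
have -> : dtG [eta a with l |-> \sum_i b i + t] =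
    \sum_i dtG [eta a with l |-> b i] + dtG [eta a with l |-> s].
  rewrite phiD phi_sum; congr (_ + _).
  rewrite /s phiD phi_sum big1 ?add0r // => j jl; apply: (dt_alt jl).
  by rewrite /= (negPf jl) eqxx.
have cramer : \sum_i dtG [eta a with l |-> b i] * dtG [eta b with i |-> s] =
    dtG b * dtG [eta a with l |-> s].
  rewrite dtG_upd -(dt_cramer _ (val \o b)); apply: eq_bigr => i _.
  by rewrite !dtG_upd.
rewrite mulrDr -cramer mulr_sumr -big_split /=.
apply: eq_bigr => i _; rewrite [dtG b * _]mulrC -mulrDr; congr (_ * _).
rewrite bs [in RHS]dtG_upd valGD slotD -!dtG_upd.
by congr (dtG _ + _); rewrite upd_same.
Qed.

Hypothesis H_span : forall v : 'rV[K]_n, v \in lspan [set` H].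

(** If the determinant vanished on all tuples in H, multilinearity and the spanning hypothesis would
    make it vanish on all tuples, the standard basis included. The list [s] holds the slots not yet
    confined to H. *)
Lemma dtG_neq0 : exists a : 'I_n -> G, dtG a != 0.
Proof.
apply: contrapT => /forallNP a0.
suff ind (s : seq 'I_n) : forall x : 'I_n -> 'rV[K]_n,
    (forall i, i \notin s -> x i \in H) -> dt x = 0.
  have /ind/eqP : forall i, i \notin enum 'I_n -> delta_mx 0 i \in H.
    by move=> i; rewrite mem_enum.
  rewrite /dt (_ : \matrix_(_, _) _ = 1%:M) ?det1 ?oner_eq0 //.
  by apply/matrixP => i j; rewrite !mxE eqxx.
elim: s => [|k s IHs] x xs.
  have xH i : x i \in H by apply: xs.
  have := a0 (fun i => exist _ (x i) (xH i)) => /negP; rewrite negbK => /eqP <-.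
  by congr dt; apply/funext.
have /asboolP[m [d [r [rH xk]]]] := H_span (x k).
rewrite -[x](upd_same _ k) xk.
rewrite (slot_linear_sum _ _ _ (@dt_slot_linear K n k)) big1 // => i _.
rewrite (slot_linearZ _ _ _ (@dt_slot_linear K n k)) IHs ?scaler0 // => j js /=.
case: eqVneq => [_|jk]; first exact: rH.
by apply: xs; rewrite inE negb_or jk.
Qed.

(** In an independent tuple some slot [i] can be exchanged for [g] without losing independence.
    Subtracting the other entries from that slot then makes the sum [g] and leaves the determinant
    unchanged. *)
Lemma dtG_neq0_sum (g : G) : g != 0 ->
  exists2 a : 'I_n -> G, dtG a != 0 & \sum_i a i = g.
Proof.
move=> g0; have [a a0] := dtG_neq0; set B := \matrix_(k, j) (val (a k)) 0 j.
have dB : \det B != 0.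
  rewrite (_ : \det B = dtG a) // /dtG /dt -det_tr; congr (\det _).
  by apply/matrixP => i j; rewrite !mxE.
(* This entry is the determinant of [a] with slot [i] replaced by [g]; they cannot all vanish, as
   [\adj B] is invertible. *)
have [i gi] : exists i, (val g *m \adj B) 0 i != 0.
  apply: contrapT => /forallNP gi; case/negP: g0; apply/eqP/val_inj.
  have gB : val g *m \adj B = 0.
    apply/rowP => i; rewrite [RHS]mxE.
    by have := gi i => /negP; rewrite negbK => /eqP.
  apply: (scalerI dB); rewrite -mul_mx_scalar -mul_adj_mx mulmxA gB mul0mx.
  by rewrite scaler0.
exists [eta a with i |-> g - \sum_(j | j != i) a j]; last first.
  rewrite (bigD1 i) //= eqxx -[RHS](subrK (\sum_(j | j != i) a j)).
  by congr (_ + _); apply: eq_bigr => j /negPf ->.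
rewrite dtG_upd dt_upd raddfB mulmxBl raddf_sum mulmx_suml.
rewrite mxE [X in _ + X]mxE summxE [X in _ - X]big1 ?subr0 // => j ji.
rewrite -dt_upd.
by apply: (dt_alt ji); rewrite /= eqxx (negPf ji).
Qed.

End WeightDeterminant.

(** * The bracket of P(H,t) *)

Section PBracket.
Context (K : fieldType) (n : nat) (H : zmodClosed 'rV[K]_n) (t : subgrp H).
Local Notation G := (subgrp H).
Local Notation A := (grpalg G K).
Local Notation P := (P_space t).

(** Replaces the finitely supported sum by a sum over tuples from one finite set containing all
    supports, so that brackets of different arguments can be compared termwise. *)
Lemma P_bracket_fset (U : {fset Lambda t}) (f : 'I_n -> P) :
    (forall i a, a \notin U -> mcoeff a (f i) = 0) ->
  P_bracket t f = \sum_(a <- [fset a in [seq [ffun i => val (h i)]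
      | h : {ffun 'I_n -> U}]]%fset)
    ((\prod_(i < n) mcoeff (a i) (f i)) *
     \det (\matrix_(i, j) val (val (a j)) 0 i)) *:
    u_ t (\sum_(j < n) val (a j) + t).
Proof.
move=> fU; apply: fsbigTE => a aU.
suff [i ai] : exists i, a i \notin U by rewrite (bigD1 i) //= fU // !mul0r scale0r.
apply: contrapT => /forallNP aiU; case/negP: aU.
have aU i : a i \in U by have /negP := aiU i; rewrite negbK.
rewrite inE; apply/codomP; exists [ffun i => [` aU i]%fset].
by apply/ffunP => i; rewrite !ffunE.
Qed.

Lemma P_bracket_linear : n_linear (P_bracket t).
Proof.
move=> x i k u v.
(* All supports that occur in the three brackets. *)
pose s := msupp u ++ msupp v ++ flatten [seq (msupp (x j) : seq _) | j : 'I_n].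
pose U := seq_fset tt s.
have UE a : a \notin U -> [/\ mcoeff a u = 0, mcoeff a v = 0 &
    forall j, mcoeff a (x j) = 0].
  rewrite seq_fsetE 2!mem_cat !negb_or => /and3P[au av ax].
  split=> [||j]; try exact: mcoeff_outdom.
  apply: mcoeff_outdom; apply: contra ax => ax.
  by apply/flatten_mapP; exists j => //; rewrite mem_enum.
rewrite !(@P_bracket_fset U) => [|j a aU|j a aU|j a aU] /=.
- rewrite scaler_sumr -big_split; apply: eq_bigr => a _ /=.
  have scale_split (L : lmodType K) (p q r d : K) (w : L) : p = k * q + r ->
      (p * d) *: w = k *: ((q * d) *: w) + (r * d) *: w.
    by move=> ->; rewrite scalerA mulrA -scalerDl -mulrDl.
  apply: scale_split.
  have prodE (f : 'I_n -> P) : \prod_j mcoeff (a j) (f j) =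
      mcoeff (a i) (f i) * \prod_(j | j != i) mcoeff (a j) (f j).
    by rewrite (bigD1 i).
  rewrite 3!prodE /= eqxx mcoeffD mcoeffZ mulrDl mulrA.
  by congr (_ * _ + _ * _); apply: eq_bigr => j /negPf ->.
- by have [_ vU xU] := UE a aU; case: eqP => _; [exact: vU | exact: xU].
- by have [uU _ xU] := UE a aU; case: eqP => _; [exact: uU | exact: xU].
- have [uU vU xU] := UE a aU; case: eqP => _; last exact: xU.
  by rewrite mcoeffD mcoeffZ uU vU mulr0 addr0.
Qed.

(* Locked, as is [diag_der] below: otherwise failing unification problems between
   two instances are unfolded down to finite maps and do not terminate. *)
Definition P_emb_def (f : P) : A :=
  \sum_(a <- msupp f) mcoeff a f *: gpow K (val a).
Definition P_emb := locked P_emb_def.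

Lemma mcoeff_P_emb b (f : P) : mcoeff b (P_emb f) =
  if insub b is Some a then mcoeff (a : Lambda t) f else 0.
Proof.
rewrite /P_emb -lock /P_emb_def raddf_sum /=.
under eq_bigr do rewrite mcoeffZ mcoeff_gpow.
case: insubP => [a ba <-|bN].
  rewrite [in RHS](monalgE f) raddf_sum; apply: eq_bigr => a' _.
  by rewrite /= mcoeffU -[in RHS]mulr_natr -val_eqE.
rewrite big1 // => a _; case: eqP => [ab|_]; last by rewrite mulr0.
by case/negP: bN; rewrite -ab (valP a).
Qed.

Lemma P_emb_linear : linear P_emb.
Proof.
move=> k u v; apply/malgP => b; rewrite [RHS]mcoeffD (mcoeffZ k (P_emb u)).
rewrite !mcoeff_P_emb; case: insub => [a|]; last by rewrite mulr0 addr0.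
by rewrite mcoeffD mcoeffZ.
Qed.

Lemma mcoeff_u (a : Lambda t) b : mcoeff a (u_ t b) = (b == val a)%:R.
Proof.
rewrite /u_; case: insubP => [a' _ <-|bN]; first by rewrite mcoeffU.
rewrite mcoeff0; case: eqP => // ba.
by case/negP: bN; rewrite ba (valP a).
Qed.

Lemma P_emb_u b : b != 0 -> b != t -> P_emb (u_ t b) = gpow K b.
Proof.
move=> b0 bt; apply/malgP => g; rewrite mcoeff_P_emb mcoeff_gpow.
case: insubP => [a _ <-|gN]; first by rewrite mcoeff_u.
by case: (eqVneq b g) gN => // <-; rewrite b0 bt.
Qed.

Lemma P_emb_val (a : Lambda t) : P_emb (u_ t (val a)) = gpow K (val a).
Proof. by case/andP: (valP a); apply: P_emb_u. Qed.

End PBracket.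

(** * Brackets given by a determinant on monomials *)

Section MonomialBracket.
Context (K : fieldType) (n : nat) (H : zmodClosed 'rV[K]_n) (t : subgrp H).
Local Notation G := (subgrp H).
Local Notation A := (grpalg G K).

Context (c : K) (br : ('I_n -> A) -> A).
Hypothesis brL : n_linear br.
Hypothesis brE : forall a : 'I_n -> G,
  br (gpow K \o a) = (c * dtG a) *: gpow K (\sum_j a j + t).

Let br_slot i : slot_linear br i. Proof. by move=> x c' u v; apply: brL. Qed.

(** Both sides are linear in every slot of [y] and in every slot of [x] other than [l], so monomials
    suffice; there the identity becomes [fundamental_dtG]. *)
Lemma monomial_bracket_fundamental : n_fundamental br.
Proof.
move=> x y l _; apply/eqP; rewrite -subr_eq0; apply/eqP; move: y.
apply: (grpalg_slot_linear_ext (P := predT)) => [j _|y b yE].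
  apply: slot_linearB => [y k u v|]; first by rewrite brL br_slot.
  apply: slot_linear_bigsum => i.
  (* In the [i]-th summand the varied entry sits inside the inner bracket when [i = j], and is an
     argument of the outer bracket otherwise. *)
  have [->|ji] := eqVneq j i => y k u v.
    by rewrite !upd_upd /= eqxx !br_slot.
  by rewrite /= eq_sym (negPf ji) !(upd_comm y _ _ ji) br_slot.
have {yE}-> : y = gpow K \o b by apply/funext => i; apply: yE.
move: x; apply: (grpalg_slot_linear_ext (P := predC1 l)) => [j jl|x a xE].
  apply: slot_linearB; first exact: slot_linear_upd.
  apply: slot_linear_bigsum => i x k u v.
  by rewrite !(upd_comm x _ _ jl) !br_slot.
have brx g : br [eta x with l |-> gpow K g] = (c * dtG [eta a with l |-> g]) *:
    gpow K (\sum_j [eta a with l |-> g] j + t).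
  rewrite -brE comp_upd; congr br; apply/funext => i /=.
  by case: eqVneq => // /xE.
have bry i g : br [eta gpow K \o b with i |-> gpow K g] =
    (c * dtG [eta b with i |-> g]) *: gpow K (\sum_j [eta b with i |-> g] j + t).
  by rewrite -brE comp_upd.
have lhsE : br [eta x with l |-> br (gpow K \o b)] =
    (c * dtG b * (c * dtG [eta a with l |-> \sum_i b i + t])) *:
    gpow K (\sum_j [eta a with l |-> \sum_i b i + t] j + t).
  by rewrite brE (slot_linearZ _ _ _ (br_slot l)) -scalerA -brx.
have rhsE i : br [eta gpow K \o b with i |-> br [eta x with l |-> gpow K (b i)]] =
    (c * dtG [eta a with l |-> b i] *
     (c * dtG [eta b with i |-> \sum_j [eta a with l |-> b i] j + t])) *:
    gpow K (\sum_j [eta b with i |-> \sum_j [eta a with l |-> b i] j + t] j + t).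
  have e1 := congr1 (fun z => br [eta gpow K \o b with i |-> z]) (brx (b i)).
  apply: (etrans e1).
  rewrite /= (slot_linearZ _ _ _ (br_slot i)) -scalerA; congr (_ *: _).
  exact: bry.
(* All monomials have the same exponent, so only the coefficients remain to be compared. *)
have sumE i : \sum_j [eta b with i |-> \sum_j [eta a with l |-> b i] j + t] j + t
    = \sum_j [eta a with l |-> \sum_i b i + t] j + t.
  rewrite (sum_upd b i (\sum_j [eta a with l |-> b i] j + t)).
  rewrite (sum_upd a l (b i)).
  rewrite (sum_upd a l (\sum_i b i + t)).
  congr (_ + _).
  have shuffle (V : zmodType) (u v w p q : V) :
      u + v - w + p + q - u = q + p + v - w.
    by rewrite [LHS]addrC !addrA addNr add0r -addrA [LHS]addrC [p + q]addrC addrA.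
  exact: shuffle.
rewrite lhsE (eq_bigr _ (fun i _ => rhsE i)).
under eq_bigr do rewrite sumE mulrACA.
by rewrite -scaler_suml mulrACA fundamental_dtG mulr_sumr subrr.
Qed.

Hypothesis brA : n_alternating br.
Hypotheses (n_gt0 : (0 < n)%N) (c_neq0 : c != 0) (t_neq0 : t != 0).
Hypothesis H_span : forall v : 'rV[K]_n, v \in lspan [set` H].

Lemma monomial_bracket_nLie : is_nLie br.
Proof. by split=> //; exact: monomial_bracket_fundamental. Qed.

Lemma mcoeff_bracket x : mcoeff t (br x) = 0.
Proof.
move: x.
apply: (@grpalg_slot_linear_ext _ _ K^o _ predT) => [i _ x k u v|x a xE].
  by rewrite br_slot mcoeffD mcoeffZ.
have -> : x = gpow K \o a by apply/funext => i; apply: xE.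
rewrite brE mcoeffZ mcoeff_gpow -[X in _ == X]add0r (inj_eq (addIr t)).
case: eqP => [a0|_]; last by rewrite mulr0.
rewrite /dtG dt_sum0 ?mulr0 ?mul0r //.
by rewrite -[LHS](raddf_sum val) a0 raddf0.
Qed.

(** For the inclusion from right to left, each [gpow K b] with [b != t] is a multiple of one bracket
    of monomials, whose exponents are independent and have sum [b - t]. *)
Lemma derived_bracketE f : (f \in derived br) = (mcoeff t f == 0).
Proof.
apply/idP/eqP => [|ft].
  move: f; apply: lspanP => [|k u v ut vt|v [x _ <-]]; first exact: mcoeff0.
    by rewrite mcoeffD mcoeffZ ut vt mulr0 addr0.
  exact: mcoeff_bracket.
rewrite [f]monalgE big_seq_cond rpred_sum // => b /andP[bf _].
rewrite malgU_scale rpredZ // -[mkmalgU b 1]/(gpow K b).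
have [a a0 aE] : exists2 a : 'I_n -> G, dtG a != 0 & \sum_i a i = b - t.
  apply: (dtG_neq0_sum H_span); rewrite subr_eq0; apply: contraTneq bf => ->.
  by rewrite -mcoeff_eq0 ft.
have -> : gpow K b = (c * dtG a)^-1 *: br (gpow K \o a).
  by rewrite brE aE subrK scalerA mulVf ?scale1r // mulf_neq0.
by rewrite rpredZ // bracket_derived.
Qed.

Lemma one_derived : 1 \in derived br.
Proof. by rewrite derived_bracketE mcoeff_gpow [0 == t]eq_sym (negPf t_neq0). Qed.

(** On monomials, the entry 1 has exponent 0, which puts a zero vector into the determinant. *)
Lemma bracket_one x i k : x i = k *: 1 -> br x = 0.
Proof.
move=> xi; rewrite -(upd_same x i) xi (slot_linearZ _ _ _ (br_slot i)).
suff -> : br [eta x with i |-> 1] = 0 by rewrite scaler0.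
move: x {xi}; apply: (@grpalg_slot_linear_ext _ _ _ _ (predC1 i)).
  by move=> j ji; apply: slot_linear_upd.
move=> x a xE; have -> : [eta x with i |-> 1] = gpow K \o [eta a with i |-> 0] :> ('I_n -> A).
  by apply/funext => j /=; case: eqVneq => // /xE.
rewrite brE dtG_upd raddf0 (slot_linear0 _ (@dt_slot_linear K n i)).
by rewrite mulr0 scale0r.
Qed.

Lemma derived_lineP (x : derived_alg br) :
  x \in derived_line br 1 -> exists k, val x = k *: 1.
Proof.
move: x; apply: lspanP => [|k u v [a ua] [b vb]|v ->].
- by exists 0; rewrite scale0r.
- by exists (k * a + b); rewrite scalerDl -scalerA -ua -vb -linearP.
- by exists 1; rewrite scale1r.
Qed.

Lemma derived_line_mem (x : derived_alg br) k :
  val x = k *: 1 -> x \in derived_line br 1.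
Proof.
move=> xk; pose e : derived_alg br := exist _ 1 one_derived.
have -> : x = k *: e by apply: val_inj; rewrite xk.
rewrite rpredZ //; apply/asboolP; exists 1%N, (fun=> 1), (fun=> e).
by split=> //; rewrite big_ord1 scale1r.
Qed.

Lemma line_central : nLie_central (derived_bracket br) (derived_line br 1).
Proof.
by move=> x i /derived_lineP[k xk]; apply: val_inj; apply: bracket_one xk.
Qed.

Lemma line_ideal : is_nLie_ideal (derived_bracket br) (derived_line br 1).
Proof. by move=> x i xI; rewrite (line_central xI) rpred0. Qed.

Lemma derived_nLie : is_nLie (derived_bracket br).
Proof.
pose phi : {linear derived_alg br -> A} := val : derived_alg br -> A.
apply: (@nLie_inj _ _ _ _ (derived_bracket br) br phi).
- exact: val_inj.
- by [].
- exact: monomial_bracket_nLie.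
Qed.

Lemma bracket_scale k x : br (fun i => k *: x i) = k ^+ n *: br x.
Proof.
suff ind (s : seq 'I_n) : uniq s ->
    br (fun i => if i \in s then k *: x i else x i) = k ^+ size s *: br x.
  rewrite -[X in _ ^+ X](size_enum_ord n) -ind ?enum_uniq //.
  by congr br; apply/funext => i; rewrite mem_enum.
elim: s => [_|j s IHs /= /andP[js us]]; first by rewrite scale1r.
rewrite exprS -scalerA -IHs //.
pose y i := if i \in s then k *: x i else x i.
have yj : y j = x j by rewrite /y (negPf js).
transitivity (br [eta y with j |-> k *: x j]); last first.
  by rewrite (slot_linearZ _ _ _ (br_slot j)) -yj upd_same.
congr br; apply/funext => i /=; rewrite inE /y.
by case: (eqVneq i j) => [->|].
Qed.

(** * The isomorphism of P(H,t) with the quotient *)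

Section Isomorphism.
Context (s : K).
Hypotheses (s_neq0 : s != 0) (sE : s ^+ n * c = s).

Let line := derived_line br 1.
Let S' := derived_bracket br.

Lemma scale_emb_derived (f : P_space t) : s *: P_emb f \in derived br.
Proof.
rewrite rpredZ // derived_bracketE mcoeff_P_emb insubF //.
by rewrite eqxx andbF.
Qed.

(** The class of the rescaled embedding. A bracket of images carries the factor [s ^+ n * c], which
    [sE] turns into the single [s] of the image of a bracket. *)
Definition P_phi (f : P_space t) : quotsp line :=
  (\pi_(quotsp line) (exist _ (s *: P_emb f) (scale_emb_derived f)))%qT.

Lemma P_phi_linear : linear P_phi.
Proof.
move=> k u v; rewrite -quotsp_pi_linear; congr (\pi_(quotsp line) _)%qT.
apply: val_inj; rewrite linearP /=.
by rewrite (P_emb_linear k u v) scalerDr !scalerA [s * k]mulrC.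
Qed.

(** Modulo the line of 1, only the coefficient at 0 is forgotten. Injectivity, surjectivity and
    compatibility with brackets thus become comparisons of coefficients. *)
Lemma P_phi_eq (f : P_space t) (w : derived_alg br) :
  reflect (forall b, b != 0 -> s * mcoeff b (P_emb f) = mcoeff b (val w))
          (P_phi f == \pi_(quotsp line) w)%qT.
Proof.
have coefE b : mcoeff b (s *: P_emb f - val w) =
    s * mcoeff b (P_emb f) - mcoeff b (val w) by rewrite mcoeffB mcoeffZ.
have oneE k b : mcoeff b (k *: 1 : A) = k * (0 == b)%:R.
  by rewrite mcoeffZ mcoeff_gpow.
apply: (iffP eqP) => [/quotsp_piP/derived_lineP[k kE] b b0|fw].
  apply/eqP; rewrite -subr_eq0 -coefE; move: kE; rewrite raddfB /= => ->.
  by rewrite oneE [0 == b]eq_sym (negPf b0) mulr0.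
(* The difference is concentrated at exponent 0, so its coefficient there is the required multiple
   of 1. *)
apply/quotsp_piP/(derived_line_mem (k := mcoeff 0 (s *: P_emb f - val w))).
rewrite raddfB /=; apply/malgP => b; rewrite oneE.
have [->|b0] := eqVneq 0 b; first by rewrite mulr1.
by rewrite mulr0 coefE fw ?subrr // eq_sym.
Qed.

Lemma P_phi_inj : injective P_phi.
Proof.
move=> f g /eqP/P_phi_eq fg; apply/malgP => a; have /andP[a0 _] := valP a.
have := fg _ a0; rewrite /= mcoeffZ 2!mcoeff_P_emb valK.
exact: mulfI.
Qed.

Lemma P_phi_surj y : exists f, P_phi f = y.
Proof.
elim/quotW: y => w.
pose f : P_space t := \sum_(b <- msupp (val w)) (s^-1 * mcoeff b (val w)) *: u_ t b.
have fE a : mcoeff a f = s^-1 * mcoeff (val a) (val w).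
  rewrite raddf_sum [in RHS](monalgE (val w)) raddf_sum mulr_sumr /=.
  by apply: eq_bigr => b _; rewrite mcoeffZ mcoeff_u mcoeffU -mulrA mulr_natr.
exists f; apply/eqP/P_phi_eq => b b0; rewrite mcoeff_P_emb.
case: insubP => [a _ <-|]; first by rewrite fE mulrA mulfV // mul1r.
(* What remains is [b = t], where an element of the derived algebra has coefficient 0. *)
rewrite b0 negbK mulr0 => /eqP ->; apply/esym/eqP.
by rewrite -derived_bracketE; apply: (valP w).
Qed.

Lemma P_phi_bracket x : P_phi (P_bracket t x) = quot_bracket S' line (P_phi \o x).
Proof.
apply/eqP; rewrite -subr_eq0; apply/eqP; move: x.
have [qlin _ _] := quot_bracket_nLie derived_nLie line_ideal.
apply: (slot_linear_ext (P := predT)) => [i _|x xM].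
  apply: slot_linearB => x k u v.
    by rewrite P_bracket_linear P_phi_linear.
  by rewrite !comp_upd P_phi_linear qlin.
have [a xE] := choice (fun i => xM i isT).
have {xM}-> : x = (fun i => u_ t (val (a i))).
  by apply/funext => i; rewrite xE /u_ valK.
apply/eqP; rewrite subr_eq0 (quot_bracket_pi derived_nLie line_ideal).
pose g i := val (a i).
apply/P_phi_eq => b b0; rewrite P_bracket_basis -[\det _]/(dtG g).
set d := \sum_j _ + t.
have brE' : br (fun i => s *: P_emb (u_ t (val (a i)))) =
    (s ^+ n * (c * dtG g)) *: gpow K d.
  rewrite bracket_scale -scalerA -brE; congr (_ *: br _).
  by apply/funext => i; rewrite P_emb_val.
rewrite [RHS](congr1 (mcoeff b) brE') mcoeff_P_emb.
(* At [b = t] both sides vanish: the embedding misses exponent [t], and so does every bracket. *)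
have [bt|bt] := eqVneq b t.
  rewrite insubF ?mulr0 bt; last by rewrite eqxx andbF.
  by rewrite -brE' mcoeff_bracket.
have pb : (b != 0) && (b != t) by rewrite b0.
pose ab : Lambda t := exist _ b pb.
have -> : insub b = Some ab by rewrite -[b]/(val ab) valK.
rewrite (mcoeffZ (dtG g) (u_ t d) ab) mcoeff_u.
rewrite (mcoeffZ (s ^+ n * (c * dtG g)) (gpow K d) b) mcoeff_gpow.
by move: (dtG g) (d == b)%:R => m e; rewrite !mulrA sE.
Qed.

Lemma P_isomorphic : nLie_isomorphic (P_bracket t) (quot_bracket S' line).
Proof.
pose phi : {linear P_space t -> quotsp line} :=
  HB.pack P_phi (GRing.isLinear.Build _ _ _ _ P_phi P_phi_linear).
have qN := quot_bracket_nLie derived_nLie line_ideal.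
split; [|exact: qN|].
  (* The axioms for P(H,t) are pulled back from the quotient. *)
  exact: (@nLie_inj _ _ _ _ _ _ phi P_phi_inj P_phi_bracket qN).
have [f fK] := choice P_phi_surj; exists phi; split; last exact: P_phi_bracket.
by exists f => // x; apply: P_phi_inj; rewrite fK.
Qed.

End Isomorphism.

End MonomialBracket.

(** * The commuting derivations *)

Section Leibniz.
Context (K : comNzRingType) (B : comAlgType K) (D : {linear B -> B}).

Definition leibniz f g := D (f * g) = D f * g + f * D g.

Lemma leibniz_linear k u v g :
  leibniz u g -> leibniz v g -> leibniz (k *: u + v) g.
Proof.
move=> ug vg; rewrite /leibniz mulrDl -scalerAl !linearP ug vg !mulrDl -!scalerAl.
by rewrite scalerDr addrACA.
Qed.

Lemma leibnizC f g : leibniz f g -> leibniz g f.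
Proof. by rewrite /leibniz mulrC => ->; rewrite addrC [D f * g]mulrC [f * D g]mulrC. Qed.

(** Additivity of [co] splits the coefficient of the product, and the shift [s] may be attached to
    either factor. *)
Lemma leibniz_monomial (G : zmodType) (e : G -> B) (co : G -> K) s :
    {morph e : a b / a + b >-> a * b} -> {morph co : a b / a + b} ->
    (forall a, D (e a) = co a *: e (a + s)) ->
  forall a b, leibniz (e a) (e b).
Proof.
move=> eD coD De a b; rewrite /leibniz -eD !De -scalerAl -scalerAr -!eD coD.
by rewrite scalerDl [a + s + b]addrAC [a + (b + s)]addrA.
Qed.

End Leibniz.

Lemma is_derivation0 (K : comNzRingType) (B : comAlgType K) :
  is_derivation (0 : B -> B).
Proof.
have E f : (0 : B -> B) f = 0 by [].
by split=> *; rewrite !E ?scaler0 ?mul0r ?mulr0 addr0.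
Qed.

Lemma is_derivation_linear (K : comNzRingType) (B : comAlgType K) k
    (D E : B -> B) :
  is_derivation D -> is_derivation E -> is_derivation (k *: D + E).
Proof.
have DE f : (k *: D + E) f = k *: D f + E f by [].
move=> [DL DM] [EL EM]; split=> [c f g|f g]; rewrite !DE.
  by rewrite DL EL !scalerDr !scalerA mulrC addrACA.
by rewrite DM EM mulrDl mulrDr -!scalerAl -!scalerAr scalerDr addrACA.
Qed.

Section CommutingFunctions.
Context (K : nzRingType) (V : lmodType K) (E : V -> V).
Hypothesis EL : forall (c : K) f g, E (c *: f + g) = c *: E f + E g.

Lemma comm_fun0 : (0 : V -> V) \o E =1 E \o (0 : V -> V).
Proof.
move=> f /=; have := EL (-1) 0 0.
by rewrite scaler0 addr0 scaleN1r addNr => E0; rewrite [RHS]E0.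
Qed.

Lemma comm_fun_linear k (D1 D2 : V -> V) :
    D1 \o E =1 E \o D1 -> D2 \o E =1 E \o D2 ->
  (k *: D1 + D2) \o E =1 E \o (k *: D1 + D2).
Proof.
move=> D1E D2E f; rewrite -[LHS]/(k *: (D1 \o E) f + (D2 \o E) f).
by rewrite D1E D2E -[RHS]/(E (k *: D1 f + D2 f)) EL.
Qed.

End CommutingFunctions.

(** * The determinant bracket of a family of derivations *)

Section SBracket.
Context (K : comNzRingType) (B : comAlgType K) (n : nat).

Lemma S_bracket_linear (D : 'I_n -> B -> B) :
  (forall i, is_derivation (D i)) -> n_linear (S_bracket D).
Proof.
move=> Dder x l k u v; rewrite /S_bracket.
pose X w := \matrix_(i, j) D i ([eta x with l |-> w] j).
(* In the expansion along column [l] the cofactors do not see that column, so they can be taken from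
   [X 0]. *)
have XE w : \det (X w) = \sum_i D i w * cofactor (X 0) i l.
  rewrite (expand_det_col _ l); apply: eq_bigr => i _.
  rewrite [X w i l]mxE /= eqxx; congr (_ * (_ * \det _)).
  apply/matrixP => p q; rewrite !mxE /= eq_sym.
  by rewrite (negPf (neq_lift l _)).
rewrite -!/(X _) !XE scaler_sumr -big_split; apply: eq_bigr => i _ /=.
by have [DL _] := Dder i; rewrite DL mulrDl scalerAl.
Qed.

Lemma S_bracket_alternating (D : 'I_n -> B -> B) : n_alternating (S_bracket D).
Proof.
move=> x i j ij xij; rewrite /S_bracket -det_tr.
by apply: (determinant_alternate ij) => k; rewrite !mxE xij.
Qed.

(** The matrix is the product of [M], the diagonal of [p], [L] and the diagonal of [q]. In the
    application [p] holds the monomials of the shifts and [q] the arguments of the bracket. *)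
Lemma det_scale_product (M L : 'M[K]_n) (p q : 'I_n -> B) :
  \det (\matrix_(i, j) \sum_k (M i k * L k j) *: (p k * q j)) =
  (\det M * \det L) *: (\prod_k p k * \prod_j q j).
Proof.
pose f := GRing.in_alg B.
have -> : \matrix_(i, j) \sum_k (M i k * L k j) *: (p k * q j) =
    map_mx f M *m diag_mx (\row_k p k) *m (map_mx f L *m diag_mx (\row_k q k)).
  apply/matrixP => i j; rewrite !mxE; apply: eq_bigr => k _.
  rewrite !mul_mx_diag !mxE /= -!scalerAl !mul1r -scalerAr scalerA.
  by rewrite mulrC.
rewrite !det_mulmx !det_diag !det_map_mx /f /= -!scalerAl -!scalerAr !mul1r.
rewrite scalerA; congr (_ *: (_ * _)).
  by apply: eq_bigr => k _; rewrite mxE.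
by apply: eq_bigr => k _; rewrite mxE.
Qed.

End SBracket.

(** * Weights, shifted diagonal derivations and their span *)

Section DiagonalDerivations.
Context (K : fieldType) (n : nat) (H : zmodClosed 'rV[K]_n) (t : subgrp H).
Local Notation G := (subgrp H).
Local Notation A := (grpalg G K).
Context (Q : 'M[K]_n) (i0 : 'I_n).
Hypotheses (Q_unit : Q \in unitmx) (t_i0 : (val t *m Q) 0 i0 != 0).
Hypothesis t_i : forall i, i != i0 -> (val t *m Q) 0 i = 0.
Hypothesis H_span : forall v : 'rV[K]_n, v \in lspan [set` H].

Definition weight i (a : G) : K := (val a *m Q) 0 i.
Definition tshift i : G := if i == i0 then t else 0.

Lemma weightD i a b : weight i (a + b) = weight i a + weight i b.
Proof. by rewrite /weight raddfD mulmxDl mxE. Qed.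

Lemma weight0 i : weight i 0 = 0.
Proof. by rewrite /weight raddf0 mul0mx mxE. Qed.

Lemma weight_inj a b : (forall i, weight i a = weight i b) -> a = b.
Proof.
move=> ab; apply/val_inj/(can_inj (mulmxK Q_unit)).
by apply/rowP => i; apply: ab.
Qed.

(** No weight sees the shift made by another derivation. This is why the derivations commute. *)
Lemma weight_tshift i j : i != j -> weight i (tshift j) = 0.
Proof.
rewrite /tshift; case: (eqVneq j i0) => [->|_ _]; first exact: t_i.
exact: weight0.
Qed.

Definition diag_der_def i (f : A) : A :=
  \sum_(a <- msupp f) (mcoeff a f * weight i a) *: gpow K (a + tshift i).
Definition diag_der := locked diag_der_def.

Lemma mcoeff_diag_der i f b : mcoeff b (diag_der i f) =
  mcoeff (b - tshift i) f * weight i (b - tshift i).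
Proof.
rewrite /diag_der -lock /diag_der_def raddf_sum /=.
rewrite [in RHS](monalgE f) raddf_sum mulr_suml; apply: eq_bigr => a _ /=.
rewrite mcoeffZ mcoeff_gpow mcoeffU -[b in LHS](subrK (tshift i)).
rewrite (inj_eq (addIr (tshift i))); case: eqVneq => [->|_]; first by rewrite mulr1.
by rewrite mulr0 mul0r.
Qed.

Lemma diag_der_linear i : linear (diag_der i).
Proof.
move=> k u v; apply/malgP => b; rewrite mcoeff_diag_der.
rewrite [RHS]mcoeffD (mcoeffZ k (diag_der i u)) !mcoeff_diag_der.
by rewrite mcoeffD mcoeffZ mulrDl mulrA.
Qed.

Lemma diag_der_gpow i a :
  diag_der i (gpow K a) = weight i a *: gpow K (a + tshift i).
Proof.
apply/malgP => b; rewrite mcoeff_diag_der mcoeffZ !mcoeff_gpow.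
rewrite -[b in RHS](subrK (tshift i)) (inj_eq (addIr (tshift i))) mulrC.
by case: (eqVneq a (b - tshift i)) => [->|_]; rewrite ?mulr1 // !mulr0.
Qed.

HB.instance Definition _ i :=
  GRing.isLinear.Build K A A *:%R (diag_der i) (diag_der_linear i).

Lemma diag_derZ i k u : diag_der i (k *: u) = k *: diag_der i u.
Proof. exact: linearZ_LR. Qed.

Lemma diag_der_derivation i : is_derivation (diag_der i).
Proof.
split; first exact: diag_der_linear.
pose D : {linear A -> A} := diag_der i.
move=> f g; apply: (grpalg_ind (P := fun f => leibniz D f g)) => [a|k u v]; last first.
  exact: leibniz_linear.
apply: leibnizC.
apply: (grpalg_ind (P := fun g => leibniz D g (gpow K a))) => [b|k u v]; last first.
  exact: leibniz_linear.
apply: (leibniz_monomial (@gpowD _ _) (@weightD i)); exact: diag_der_gpow.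
Qed.

Lemma diag_der_comm i j f : diag_der i (diag_der j f) = diag_der j (diag_der i f).
Proof.
have [->//|ij] := eqVneq i j; have ji : j != i by rewrite eq_sym.
have DD k l a : k != l -> diag_der k (diag_der l (gpow K a)) =
    (weight k a * weight l a) *: gpow K (a + tshift k + tshift l).
  move=> kl; apply: (etrans (congr1 (diag_der k) (diag_der_gpow l a))).
  apply: (etrans (diag_derZ _ _ _)).
  have -> : weight k a = weight k (a + tshift l) by rewrite weightD weight_tshift ?addr0.
  have -> : a + tshift k + tshift l = a + tshift l + tshift k by rewrite addrAC.
  by rewrite diag_der_gpow scalerA mulrC.
pose Di : {linear A -> A} := diag_der i; pose Dj : {linear A -> A} := diag_der j.
apply: (grpalg_ind (P := fun f => Di (Dj f) = Dj (Di f))) => [a|k u v fu fv].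
  apply: (etrans (DD _ _ _ ij)); apply: (etrans _ (esym (DD _ _ _ ji))).
  by rewrite mulrC addrAC.
by rewrite !linearP fu fv.
Qed.

Definition diag_span : {pred A -> A} := lspan (range diag_der).

Lemma diag_span_der D : D \in diag_span -> is_derivation D.
Proof.
move: D; apply: lspanP => [|k D E|D [i _ <-]]; first exact: is_derivation0.
  exact: is_derivation_linear.
exact: diag_der_derivation.
Qed.

Lemma diag_span_comm D E :
  D \in diag_span -> E \in diag_span -> D \o E =1 E \o D.
Proof.
move=> Dg Eg; have [EL _] := diag_span_der Eg; move: D Dg.
apply: lspanP => [|k D1 D2|D [i _ <-]].
- exact: comm_fun0.
- exact: comm_fun_linear.
have {EL} [DL _] := diag_der_derivation i.
suff : diag_der i \o E =1 E \o diag_der i by [].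
move=> f; apply/esym; move: E Eg f.
apply: lspanP => [|k E1 E2|E [j _ <-] f].
- exact: comm_fun0.
- exact: comm_fun_linear.
- exact: diag_der_comm.
Qed.

Lemma diag_span_lie : is_lie_subalgebra_Der diag_span /\ lie_abelian diag_span.
Proof.
have comm0 D E : D \in diag_span -> E \in diag_span -> commutator D E = 0.
  move=> Dg Eg; apply/funext => f; rewrite /commutator.
  by rewrite -[D (E f)]/((D \o E) f) diag_span_comm // subrr.
split=> //; split; first exact: diag_span_der.
by move=> D E Dg Eg; rewrite comm0 ?rpred0.
Qed.

Lemma t_neq0_of_weight : t != 0.
Proof. by apply: contraNneq t_i0 => ->; rewrite raddf0 mul0mx mxE. Qed.

(** First [c i0] is isolated by its shift; the remaining derivations are diagonal, and their weights
    are independent because H spans and [Q] is invertible. *)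
Lemma diag_der_free (c : 'I_n -> K) :
  \sum_i c i *: diag_der i = 0 -> forall i, c i = 0.
Proof.
move=> c0.
(* The coefficient at [b] of the relation applied to the monomial of [a]. *)
have coef a b : \sum_i c i * weight i a * (a + tshift i == b)%:R = 0.
  have := congr1 (fun D : A -> A => mcoeff b (D (gpow K a))) c0.
  rewrite fct_sumE /= => c0b.
  transitivity (mcoeff b (\sum_(i < n) (c i *: diag_der i) (gpow K a))); last first.
    by rewrite c0b; exact: mcoeff0.
  rewrite raddf_sum; apply: eq_bigr => i _ /=.
  rewrite -[RHS]/(mcoeff b (c i *: diag_der i (gpow K a))) diag_der_gpow.
  by rewrite scalerA mcoeffZ mcoeff_gpow.
have ci0 : c i0 = 0.
  (* From the monomial of [t], only the derivation [i0] reaches exponent [t + t], with coefficient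
     [weight i0 t != 0]. *)
  have := coef t (t + t); rewrite (bigD1 i0) //= big1 => [|i /negPf ii0].
    rewrite addr0 /tshift eqxx eqxx mulr1 => /eqP; rewrite mulf_eq0.
    by rewrite (negPf t_i0) orbF => /eqP.
  rewrite /tshift ii0 (inj_eq (addrI t)) eq_sym (negPf t_neq0_of_weight).
  by rewrite mulr0.
pose w := Q *m \col_i c i.
(* For [v] in H this is the diagonal coefficient of the relation; the spanning hypothesis extends it
   to all [v]. *)
have w0 (v : 'rV_n) : v *m w = 0.
  move: v (H_span v); apply: lspanP => [|k u v u0 v0|v vH]; first by rewrite mul0mx.
    by rewrite mulmxDl -scalemxAl u0 v0 scaler0 addr0.
  pose a : G := exist _ v vH; apply/matrixP => i j; rewrite !ord1 mulmxA mxE [RHS]mxE.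
  rewrite -[RHS](coef a a); apply: eq_bigr => l _; rewrite [X in _ * X = _]mxE mulrC.
  rewrite /tshift; case: (eqVneq l i0) => [->|_]; first by rewrite ci0 !mul0r.
  by rewrite addr0 eqxx mulr1.
have cw : \col_i c i = 0.
  rewrite -[LHS]mul1mx -(mulVmx Q_unit) -mulmxA -/w -[w]mul1mx.
  have -> : 1%:M *m w = 0.
    by apply/row_matrixP => i; rewrite mul1mx rowE w0 row0.
  by rewrite mulmx0.
by move=> i; have /colP/(_ i) := cw; rewrite !mxE.
Qed.

Lemma diag_span_basis : is_basis diag_der diag_span.
Proof. by split=> //; apply: diag_der_free. Qed.

(** Each family is expressed through the other. Composing the two expressions gives relations among
    the [diag_der], so by freeness the product of the transition matrices is the identity. *)
Lemma diag_span_change (D : 'I_n -> A -> A) : is_basis D diag_span ->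
  exists2 M : 'M[K]_n, M \in unitmx & forall i, D i = \sum_k M i k *: diag_der k.
Proof.
move=> [_ DE].
have /choice[m mE] : forall i, exists m : 'I_n -> K, D i = \sum_k m k *: diag_der k.
  move=> i; apply: (@lspan_rangeP _ (A -> A)).
  rewrite -/diag_span DE; apply: lspan_mem; by exists i.
have /choice[p pE] : forall k, exists p : 'I_n -> K, diag_der k = \sum_i p i *: D i.
  move=> k; apply: (@lspan_rangeP _ (A -> A)).
  by rewrite -DE; apply: lspan_mem; exists k.
exists (\matrix_(i, k) m i k) => [|i]; last first.
  by rewrite mE; apply: eq_bigr => k _; rewrite mxE.
suff /mulmx1_unit[] : (\matrix_(i, k) p i k) *m (\matrix_(i, k) m i k) = 1%:M by [].
apply/matrixP => i j; rewrite !mxE; apply/eqP; rewrite -subr_eq0; apply/eqP.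
under eq_bigr do rewrite !mxE.
move: j; apply: (diag_der_free (c := fun j => \sum_k p i k * m k j - (i == j)%:R)).
under eq_bigr do rewrite scalerBl scaler_suml.
rewrite sumrB exchange_big /=; apply/eqP; rewrite subr_eq0; apply/eqP.
rewrite [RHS](bigD1 i) //= eqxx scale1r [X in _ + X]big1 ?addr0; last first.
  by move=> j ji; rewrite eq_sym (negPf ji) scale0r.
rewrite [RHS]pE; apply: eq_bigr => k _; rewrite mE scaler_sumr.
by apply: eq_bigr => j _; rewrite scalerA.
Qed.

Lemma sum_tshift : \sum_i tshift i = t.
Proof.
rewrite (bigD1 i0) //= big1 ?addr0 => [|i /negPf ii0].
  by rewrite /tshift eqxx.
by rewrite /tshift ii0.
Qed.

Lemma det_weight (a : 'I_n -> G) :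
  \det (\matrix_(k, j) weight k (a j)) = \det Q * dtG a.
Proof.
rewrite -(det_tr Q) -det_mulmx; congr (\det _); apply/matrixP => k j.
by rewrite mxE /weight mxE [RHS]mxE; apply: eq_bigr => l _; rewrite !mxE mulrC.
Qed.

(** In column [j] each [diag_der k] contributes its weight, the monomial of [tshift k] and that of
    [a j], so [det_scale_product] applies; the shifts together contribute the exponent [t]. *)
Lemma S_bracket_gpow (D : 'I_n -> A -> A) (M : 'M[K]_n) (a : 'I_n -> G) :
    (forall i, D i = \sum_k M i k *: diag_der k) ->
  S_bracket D (gpow K \o a) =
  (\det M * \det Q * dtG a) *: gpow K (\sum_j a j + t).
Proof.
move=> DE; rewrite -mulrA -det_weight addrC -[in RHS]sum_tshift.
have gpow_sum (g : 'I_n -> G) : gpow K (\sum_i g i) = \prod_i gpow K (g i).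
  exact: (big_morph _ (@gpowD _ K) (@gpow_0 _ K)).
rewrite gpowD !gpow_sum -det_scale_product; congr (\det _).
apply/matrixP => i j; rewrite !mxE /= DE fct_sumE; apply: eq_bigr => k _.
rewrite -[LHS]/(M i k *: diag_der k (gpow K (a j))) diag_der_gpow scalerA.
by rewrite [in RHS]mxE -gpowD addrC.
Qed.

Lemma diag_span_simple : g_simple diag_span.
Proof.
move=> [I [[I0 I1 IP] [f0 f0I f0_neq0] DI]].
have ID u v : u \in I -> v \in I -> u + v \in I.
  by move=> uI vI; rewrite -[u]mul1r IP.
have IM (a : A) u : u \in I -> a * u \in I.
  by move=> uI; rewrite -[_ * _]addr0 IP.
have IZ k u : u \in I -> k *: u \in I.
  by move=> uI; rewrite -[u]mul1r scalerAl IM.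
(* Induction on a bound for the size of the support shows that a proper invariant ideal is zero. *)
suff main m : forall f, (#|` msupp f| <= m)%N -> f \in I -> f = 0.
  by move/eqP: f0_neq0; apply; apply: (main #|` msupp f0|).
elim: m => [|m IHm] f fm fI; apply: contrapT => /eqP f_neq0.
  move: fm; rewrite leqn0 cardfs_eq0 => /eqP f0'; case/eqP: f_neq0.
  by rewrite [f]monalgE f0' big_seq_fset0.
have [a af] : exists a, a \in msupp f.
  apply: contrapT => /forallNP fN; case/eqP: f_neq0; apply/malgP => b.
  by rewrite mcoeff0; apply: mcoeff_outdom; apply/negP/fN.
have [/eqP fa|fa] := boolP (msupp f == [fset a]%fset).
  have fE : f = mcoeff a f *: gpow K a.
    by rewrite {1}[f]monalgE fa big_seq_fset1 malgU_scale.
  case/negP: I1.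
  have -> : 1 = (mcoeff a f)^-1 *: (gpow K (- a) * f).
    rewrite [in gpow K (- a) * _]fE -scalerAr -gpowD addNr scalerA mulVf ?scale1r //.
    by rewrite mcoeff_neq0.
  exact/IZ/IM.
have [b bf ba] : exists2 b, b \in msupp f & b != a.
  apply: contrapT => /forall2NP fN; case/negP: fa; apply/eqP/fsetP => b.
  rewrite inE; apply/idP/eqP => [bf|-> //].
  by have [|/negP] := fN b; [rewrite bf|rewrite negbK => /eqP].
have [i iab] : exists i, weight i b != weight i a.
  apply: contrapT => /forallNP wab; case/eqP: ba; apply: weight_inj => i.
  by apply/eqP; have /negP := wab i; rewrite negbK.
(* Multiplying by the inverse monomial undoes the shift, leaving the pure weight operator.
   Subtracting [weight i a *: f] removes [a] from the support and keeps [b]. *)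
pose h := gpow K (- tshift i) * diag_der i f - weight i a *: f.
have hI : h \in I.
  rewrite /h -scaleNr ID ?IZ // IM //; apply: DI => //.
  by apply: lspan_mem; exists i.
have hc c : mcoeff c h = mcoeff c f * (weight i c - weight i a).
  rewrite mcoeffB mcoeffZ mcoeff_gpowM opprK mcoeff_diag_der addrK mulrBr.
  by rewrite [weight i a * _]mulrC.
(* The support of [h] lies in that of [f] without [a], so the induction hypothesis gives [h = 0],
   against its nonzero coefficient at [b]. *)
have /malgP/(_ b) : h = 0.
  apply: IHm hI; rewrite -ltnS; apply: leq_trans fm.
  rewrite [X in (_ < X)%N](cardfsD1 a) af ltnS; apply/fsubset_leq_card/fsubsetP => c.
  rewrite inE -!mcoeff_neq0 hc; apply: contraR.
  rewrite negb_and !negbK inE => /orP[/eqP ->|/eqP ->].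
    by rewrite subrr mulr0.
  by rewrite mul0r.
rewrite hc mcoeff0 => /eqP; rewrite mulf_eq0 subr_eq0 (negPf iab) orbF.
by rewrite mcoeff_eq0 bf.
Qed.

End DiagonalDerivations.

(** * Choice of the forms and of the scaling, and assembly *)

Lemma exists_dual_coordinates (K : fieldType) n (v : 'rV[K]_n) :
    (0 < n)%N -> v != 0 ->
  exists (Q : 'M[K]_n) (i0 : 'I_n), [/\ Q \in unitmx, (v *m Q) 0 i0 != 0 &
    forall i, i != i0 -> (v *m Q) 0 i = 0].
Proof.
move=> n_gt0 v_neq0; pose Q := invmx (row_ebase v); pose i0 := Ordinal n_gt0.
have Q_unit : Q \in unitmx by rewrite unitmx_inv row_ebase_unit.
have vQ i : i != i0 -> (v *m Q) 0 i = 0.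
  (* By Gaussian elimination [v] is a scalar times the first row of [row_ebase v], so [v *m Q] is
     concentrated in position 0. *)
  move=> ii0; rewrite -{1}(mulmx_ebase v) /Q mulmxK ?row_ebase_unit // mxE.
  rewrite big_ord1 mxE [_ == _](_ : _ = false) ?mulr0 //.
  by apply: contraNF ii0 => /eqP i0E; apply/eqP/val_inj; rewrite /= -i0E.
exists Q, i0; split=> //; apply: contraNneq v_neq0 => vQ0.
rewrite -[v](mulmxK Q_unit) [v *m Q](_ : _ = 0) ?mul0mx //.
by apply/rowP => i; rewrite [RHS]mxE; have [->|/vQ] := eqVneq i i0.
Qed.

Lemma exists_scaling (C : numClosedFieldType) n (c : C) : (1 < n)%N -> c != 0 ->
  exists2 s, s != 0 & s ^+ n * c = s.
Proof.
(* The arity is now [n.+2], so the root taken has order one less than the arity. *)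
case: n => [|[|n]] // _ c0; exists (n.+1.-root c^-1)%C.
  by rewrite rootC_eq0 // invr_eq0.
by rewrite exprS -mulrA rootCK // mulVf // mulr1.
Qed.

(** Stated over any [numClosedFieldType]: beyond the field axioms, the argument uses only the root
    extracted in [exists_scaling]. *)
Lemma group_algebra_realization (C : numClosedFieldType) (n : nat)
    (n_ge3 : (3 <= n)%N)
    (H : zmodClosed 'rV[C]_n)
    (H_span : forall v : 'rV[C]_n, v \in lspan [set` H])
    (t : subgrp H) (t_neq0 : t != 0) :
  let CH : comAlgType C := grpalg (subgrp H) C in
  exists g : submodClosed (CH -> CH),
    [/\ is_lie_subalgebra_Der g, has_dim g n, lie_abelian g, g_simple g &
      forall D : 'I_n -> CH -> CH, is_basis D g ->
        let S := S_bracket D in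
        let S' := derived_bracket S in
        let one_line := derived_line S 1 in
        [/\ is_nLie S, 1 \in derived S,
            is_nLie_ideal S' one_line, nLie_central S' one_line &
            nLie_isomorphic (P_bracket t) (quot_bracket S' one_line)]].
Proof.
move=> CH; have n_gt0 : (0 < n)%N by apply: leq_trans n_ge3.
have vt_neq0 : val t != 0.
  by apply: contraNneq t_neq0 => t0; apply/eqP/val_inj; rewrite t0 raddf0.
have [Q [i0 [Q_unit t_i0 t_i]]] := exists_dual_coordinates n_gt0 vt_neq0.
have [g_lie g_abelian] := diag_span_lie t_i.
pose d : 'I_n -> CH -> CH := diag_der t Q i0.
pose g : submodClosed (CH -> CH) := lspan (range d).
exists g; split.
- exact: g_lie.
- by exists (diag_der t Q i0); apply: diag_span_basis.
- exact: g_abelian.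
- exact: diag_span_simple.
move=> D D_basis S S' one_line.
have [M M_unit DE] := diag_span_change Q_unit t_i0 H_span D_basis.
have D_der i : is_derivation (D i).
  by case: g_lie => + _; apply; case: D_basis => _ ->; apply: lspan_mem; exists i.
have S_lin : n_linear S by apply: S_bracket_linear.
have S_alt : n_alternating S by apply: S_bracket_alternating.
(* The basis [D] is arbitrary and enters the bracket of monomials only through [\det M]; hence [s]
   is chosen after [D]. *)
pose c := \det M * \det Q.
have c_neq0 : c != 0 by rewrite mulf_neq0 // -unitfE.
have S_gpow (a : 'I_n -> subgrp H) :
    S (gpow C \o a) = (c * dtG a) *: gpow C (\sum_j a j + t).
  exact: (S_bracket_gpow _ DE).
have [s s_neq0 sE] := exists_scaling (leq_trans (isT : (1 < 3)%N) n_ge3) c_neq0.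
split.
- exact: monomial_bracket_nLie S_gpow S_alt.
- exact: one_derived S_gpow _ _ _ _.
- exact: line_ideal S_gpow.
- exact: line_central S_gpow.
- exact: P_isomorphic S_gpow _ _ _ _ _ _ s_neq0 sE.
Qed.

Theorem proposition7p1 (R : realType) (n : nat) (n_ge3 : (3 <= n)%N)
    (H : zmodClosed 'rV[R[i]]_n)
    (H_span : forall v : 'rV[R[i]]_n, v \in lspan [set` H])
    (t : subgrp H) (t_neq0 : t != 0) :
  let CH : comAlgType R[i] := grpalg (subgrp H) R[i] in
  exists g : submodClosed (CH -> CH),
    [/\ is_lie_subalgebra_Der g, has_dim g n, lie_abelian g, g_simple g &
      forall D : 'I_n -> CH -> CH, is_basis D g ->
        let S := S_bracket D in
        let S' := derived_bracket S in
        let one_line := derived_line S 1 in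
        [/\ is_nLie S, 1 \in derived S,
            is_nLie_ideal S' one_line, nLie_central S' one_line &
            nLie_isomorphic (P_bracket t) (quot_bracket S' one_line)]].
Proof. exact: (@group_algebra_realization R[i]). Qed.
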